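(* Let $d\in\mathbb{N}$. Then $A_{\mathrm{sym}}(\mathbb{D}^d)$ is a projective-free ring.
   Context: $\mathbb{N}=\{1,2,3,\dots\}$, $\mathbb{D}=\{z\in\mathbb{C}:|z|<1\}$, and $\overline{\mathbb{D}}$ is its closure in $\mathbb{C}$. For $d\in\mathbb{N}$, $A(\mathbb{D}^d)$ is the polydisc algebra of all functions $f:\overline{\mathbb{D}}^d\to\mathbb{C}$ that are holomorphic in $\mathbb{D}^d$ and continuous on $\overline{\mathbb{D}}^d$, with pointwise operations. The symmetric group $S_d$ of all permutations of $\{1,\dots,d\}$ acts by $\sigma\mathbf{z}=(z_{\sigma(1)},\dots,z_{\sigma(d)})$ for $\mathbf{z}=(z_1,\dots,z_d)\in\mathbb{C}^d$. A function $f\in A(\mathbb{D}^d)$ is symmetric if $f(\sigma\mathbf{z})=f(\mathbf{z})$ for all $\mathbf{z}\in\mathbb{D}^d$ and all $\sigma\in S_d$. $A_{\mathrm{sym}}(\mathbb{D}^d)$ is the subalgebra of $A(\mathbb{D}^d)$ consisting of all symmetric functions in $A(\mathbb{D}^d)$. A commutative unital ring $R$ is projective-free if every finitely generated projective $R$-module is free. A finitely generated $R$-module $M$ is free if $M\simeq R^k$ for some integer $k\geq 0$, and projective if there exist an $R$-module $N$ and an integer $m\geq 0$ such that $M\oplus N\simeq R^m$. *)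

(* Defs.v *)
From HB Require Import structures.
From mathcomp Require Import all_boot all_order all_fingroup all_algebra.
From mathcomp Require Import complex.
From mathcomp Require Import all_classical all_reals all_analysis.

Set Implicit Arguments.
Unset Strict Implicit.
Unset Printing Implicit Defensive.
Import Order.TTheory GRing.Theory Num.Theory.
Import numFieldNormedType.Exports.

Local Open Scope classical_set_scope.
Local Open Scope ring_scope.

Section ProjectiveFree.

Definition isomorphic_modules (A : pzRingType) (M N : lmodType A) : Prop :=
  exists f : {linear M -> N}, bijective f.

Definition finitely_generated (A : pzRingType) (M : lmodType A) : Prop :=
  exists (n : nat) (g : 'I_n -> M),
    forall x : M, exists a : 'I_n -> A, x = \sum_(i < n) a i *: g i.

Definition free_module (A : pzRingType) (M : lmodType A) : Prop :=
  exists k : nat, isomorphic_modules M 'rV[A]_k.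

Definition projective_module (A : pzRingType) (M : lmodType A) : Prop :=
  exists (N : lmodType A) (m : nat),
    isomorphic_modules (M * N)%type 'rV[A]_m.

Definition projective_free (A : comPzRingType) : Prop :=
  forall M : lmodType A,
    finitely_generated M -> projective_module M -> free_module M.

End ProjectiveFree.

(* R[i] comes without a topology: give it that of its norm, as every
   numFieldType K has through K^o. *)
HB.instance Definition _ (R : realType) :=
  PseudoPointedMetric.copy R[i] R[i]^o.
HB.instance Definition _ (R : realType) := NormedModule.copy R[i] R[i]^o.

Definition polydisc (R : realType) (d : nat) : set 'rV[R[i]]_d :=
  [set z | forall j, `|z 0 j| < 1].

Definition closed_polydisc (R : realType) (d : nat) : set 'rV[R[i]]_d :=
  [set z | forall j, `|z 0 j| <= 1].

Arguments polydisc : clear implicits.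
Arguments closed_polydisc : clear implicits.

Section PolydiscAlgebra.
Variables (R : realType) (d : nat).

(* 'valL_0 f extends f by 0 to all of 'rV[R[i]]_d. The polydisc is open, so at
   its points the extension is (Frechet) differentiable over R[i] exactly when
   f is. *)
Definition holomorphic_in_polydisc (f : closed_polydisc R d -> R[i]) : Prop :=
  forall z, polydisc R d z -> differentiable ('valL_0 f) z.

Definition polydisc_algebra : set (closed_polydisc R d -> R[i]) :=
  [set f | holomorphic_in_polydisc f /\ continuous f].

(* col_perm s z is the row (z 0 (s j))_j. *)
Definition symmetric_in_polydisc (f : closed_polydisc R d -> R[i]) : Prop :=
  forall (s : 'S_d) z, polydisc R d z ->
    'valL_0 f (col_perm s z) = 'valL_0 f z.

Definition sym_polydisc_algebra : set (closed_polydisc R d -> R[i]) :=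
  [set f | polydisc_algebra f /\ symmetric_in_polydisc f].

Lemma polydiscW z : polydisc R d z -> closed_polydisc R d z.
Proof. by move=> Dz j; exact/ltW/Dz. Qed.

Lemma polydisc_perm (s : 'S_d) z :
  polydisc R d z -> polydisc R d (col_perm s z).
Proof. by move=> Dz j; rewrite mxE. Qed.

Lemma polydisc_nbhs z : polydisc R d z -> nbhs z (polydisc R d).
Proof.
have -> : polydisc R d = ball (0 : 'rV[R[i]]_d) 1.
  apply/seteqP; split => w /= => [Dw|[_ Dw] j].
    by split=> // i j; rewrite ord1 -ball_normE /= mxE sub0r normrN.
  by have := Dw 0 j; rewrite -ball_normE /= mxE sub0r normrN.
by move=> zB; apply: open_nbhs_nbhs; split => //; exact: ball_open.
Qed.

Lemma valL_cst1 z : polydisc R d z ->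
  'valL_0 (1 : closed_polydisc R d -> R[i]) z = 1.
Proof.
move=> /polydiscW Dz; rewrite /valL_ /= oinv_set_val insubT ?inE //.
Qed.

Lemma valLB (f g : closed_polydisc R d -> R[i]) :
  'valL_0 (f - g) = 'valL_0 f - 'valL_0 g.
Proof.
apply/funext => z; rewrite /valL_ !fctE /= oinv_set_val.
by case: insub => [x|] /=; rewrite ?subr0.
Qed.

Lemma valLM (f g : closed_polydisc R d -> R[i]) :
  'valL_0 (f * g) = 'valL_0 f * 'valL_0 g.
Proof.
apply/funext => z; rewrite /valL_ !fctE /= oinv_set_val.
by case: insub => [x|] /=; rewrite ?mulr0.
Qed.

Lemma differentiable_near_cst (f : 'rV[R[i]]_d -> R[i]) a z :
  (\forall w \near z, f w = a) -> differentiable f z.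
Proof.
move=> fa; have faz : f z = a by exact: nbhs_singleton fa.
have fE : f \o shift z = cst (f z) + 0 +o_ 0 id.
  apply/eqaddoP => e e0; rewrite near_simpl.
  have := fa; rewrite (near_shift 0) subr0 => h.
  near=> w; rewrite !fctE /= faz.
  have -> : f (w + z) = a by near: w.
  by rewrite addr0 subrr normr0 mulr_ge0 // ltW.
have c0 : continuous (0 : 'rV[R[i]]_d -> R[i]) by exact: cst_continuous.
by apply/diff_locallyP; rewrite (diff_unique c0 fE).
Unshelve. all: by end_near. Qed.

Lemma sym_polydisc_algebra_subring : subring_closed [in sym_polydisc_algebra].
Proof.
split=> [|f g|f g]; rewrite !inE.
- split; [split|] => [z Dz||s z Dz].
  + apply: (@differentiable_near_cst _ 1).
    by apply: filterS (polydisc_nbhs Dz) => w; exact: valL_cst1.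
  + exact: cst_continuous.
  + by rewrite !valL_cst1 //; exact: polydisc_perm.
- move=> [[hf cf] sf] [[hg cg] sg]; split; [split|] => [z Dz|z|s z Dz].
  + by rewrite valLB; apply: differentiableB; [exact: hf|exact: hg].
  + exact: continuousB (cf z) (cg z).
  + by rewrite valLB !fctE sf // sg.
- move=> [[hf cf] sf] [[hg cg] sg]; split; [split|] => [z Dz|z|s z Dz].
  + by rewrite valLM; apply: differentiableM; [exact: hf|exact: hg].
  + exact: continuousM (cf z) (cg z).
  + by rewrite valLM !fctE sf // sg.
Qed.

Definition Asym := {f | f \in sym_polydisc_algebra}.
HB.instance Definition _ := SubChoice.on Asym.
HB.instance Definition _ := GRing.SubChoice_isSubComPzRing.Build
  (closed_polydisc R d -> R[i]) [in sym_polydisc_algebra] Asym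
  sym_polydisc_algebra_subring.

End PolydiscAlgebra.

Arguments Asym : clear implicits.

(* Main.v *)
From HB Require Import structures.
Require Import Defs.
From mathcomp Require Import all_boot all_order all_algebra.
From mathcomp Require Import complex.
From mathcomp Require Import all_classical all_reals all_analysis.

(** The polydisc contracts to its centre through the symmetric dilations
z |-> r z, and a finitely generated projective module cannot change along a
continuous deformation, so it is isomorphic to an extension of scalars of a
finite-dimensional complex vector space, which is free.

A finitely generated projective module over a commutative ring A is the image
of an idempotent matrix P, and it is free when P = X Y with Y X = 1 ([splits],
[projective_free_splits]); over a field every idempotent splits, by a rank
factorization.  If P and Q are idempotents, U = P Q + (1 - P) (1 - Q)
([bridge]) satisfies P U = U Q, so P and Q are similar as soon as det U is
invertible ([splits_bridge]).

Let P be idempotent over the symmetric polydisc algebra and let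
P_t(z) = P(r z), where r = min(1, |t|).  Then P_1 = P, while P_0 = P(0) is a
constant matrix and splits.  In this algebra a function is invertible as soon
as it has no zero on the closed polydisc ([Asym_invertible]).  The function
(z, t) |-> det (P_s P_t + (1 - P_s) (1 - P_t)) (z) is continuous and equals 1
for t = s; by compactness of the closed polydisc, for t close to s it has no
zero at all ([near_splits]).  Hence the set of the t such that P_t splits is
open and closed in the connected real line; it contains 0, so it contains 1. *)

Set Implicit Arguments.
Unset Strict Implicit.
Unset Printing Implicit Defensive.
Import Order.TTheory GRing.Theory Num.Theory.
Import numFieldNormedType.Exports.

Local Open Scope ring_scope.
Local Open Scope classical_set_scope.
Local Open Scope complex_scope.

(** * Idempotent matrices and projective modules *)

Section Idempotents.
Variable A : comPzRingType.

Definition splits m (P : 'M[A]_m) : Prop :=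
  exists (r : nat) (X : 'M[A]_(m, r)) (Y : 'M[A]_(r, m)),
    X *m Y = P /\ Y *m X = 1%:M.

(** If M * N is isomorphic to A^m, the projection onto M along N becomes right
multiplication by an idempotent matrix P on A^m.  When P = X Y with Y X = 1,
right multiplications by X and Y are inverse isomorphisms between the image of
P, which is a copy of M, and A^r. *)
Lemma projective_free_splits :
  (forall m (P : 'M[A]_m), P *m P = P -> splits P) -> projective_free A.
Proof.
move=> splitA M _ [N [m [f [g fK gK]]]].
have gL a u v : g (a *: u + v) = a *: g u + g v.
  by apply: (can_inj fK); rewrite linearP !gK.
have padL a (x y : M) :
    a *: (x, 0 : N) + (y, 0) = (a *: x + y, 0) :> (M * N)%type.
  by apply/eqP; rewrite xpair_eqE /= scaler0 addr0 !eqxx.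
pose e (u : 'rV[A]_m) := f ((g u).1, 0).
have eL a u v : e (a *: u + v) = a *: e u + e v.
  by rewrite /e gL -padL linearP.
pose P := \matrix_i e (delta_mx 0 i).
pose eLin := HB.pack_for {linear 'rV[A]_m -> 'rV[A]_m} e
  (GRing.isLinear.Build _ _ _ _ e eL).
have eE u : e u = u *m P.
  have -> : e u = eLin u by [].
  rewrite [in LHS](row_sum_delta u) linear_sum mulmx_sum_row.
  by apply: eq_bigr => i _; rewrite linearZ rowK.
have PP : P *m P = P.
  by apply/row_matrixP => i; rewrite row_mul -eE rowK /e fK.
have [r [X [Y [XY YX]]]] := splitA _ _ PP.
exists r.
pose h x : 'rV[A]_r := f (x, 0) *m X.
have hL a x y : h (a *: x + y) = a *: h x + h y.
  by rewrite /h -padL linearP mulmxDl scalemxAl.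
pose hLin := HB.pack_for {linear M -> 'rV[A]_r} h
  (GRing.isLinear.Build _ _ _ _ h hL).
exists hLin; exists (fun v => (g (v *m Y)).1) => [x|v] /=.
  by rewrite /h -mulmxA XY -eE /e !fK.
rewrite /h -/(e (v *m Y)) eE -XY -(mulmxA v) (mulmxA Y) YX mul1mx -mulmxA.
by rewrite YX mulmx1.
Qed.

Lemma splits_conj m (P Q U V : 'M[A]_m) :
  P *m U = U *m Q -> U *m V = 1%:M -> V *m U = 1%:M -> splits Q -> splits P.
Proof.
move=> PU UV VU [r [X [Y [XY YX]]]]; exists r, (U *m X), (Y *m V); split.
  by rewrite mulmxA -(mulmxA U) XY -PU -mulmxA UV mulmx1.
by rewrite mulmxA -(mulmxA Y) VU mulmx1.
Qed.

(** For idempotent P and Q, a map from the image and kernel of Q to those of P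
that is close to the identity when P is close to Q. *)
Definition bridge m (P Q : 'M[A]_m) := P *m Q + (1%:M - P) *m (1%:M - Q).

Lemma bridgexx m (P : 'M[A]_m) : P *m P = P -> bridge P P = 1%:M.
Proof.
move=> PP; rewrite /bridge mulmxBr mulmx1 mulmxBl mul1mx PP subrr subr0.
by rewrite addrC subrK.
Qed.

(** With U = bridge P Q, both P U and U Q equal P Q, so an invertible U
conjugates Q to P; its inverse is computed by Cramer's rule. *)
Lemma splits_bridge m (P Q : 'M[A]_m) c : P *m P = P -> Q *m Q = Q ->
  \det (bridge P Q) * c = 1 -> splits P <-> splits Q.
Proof.
move=> PP QQ; set U := bridge P Q => Uc.
pose V := c *: \adj U.
have UV : U *m V = 1%:M.
  by rewrite -scalemxAr mul_mx_adj scale_scalar_mx mulrC Uc.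
have VU : V *m U = 1%:M.
  by rewrite -scalemxAl mul_adj_mx scale_scalar_mx mulrC Uc.
have PU : P *m U = P *m Q.
  rewrite mulmxDr !mulmxA PP [P *m (_ - P)]mulmxBr mulmx1 PP subrr.
  by rewrite mul0mx addr0.
have UQ : U *m Q = P *m Q.
  rewrite mulmxDl -!mulmxA QQ [(_ - Q) *m Q]mulmxBl mul1mx QQ subrr.
  by rewrite mulmx0 addr0.
split; last by apply: (splits_conj (U := U) (V := V)); rewrite ?PU.
apply: (splits_conj (U := V) (V := U)) => //.
by rewrite -[LHS]mul1mx -VU -mulmxA (mulmxA U) UQ -PU -(mulmxA P) UV mulmx1.
Qed.

End Idempotents.

(** A rank factorization P = X Y works: X Y X Y = X Y, and X and Y can be
cancelled. *)
Lemma splits_field (F : fieldType) m (P : 'M[F]_m) : P *m P = P -> splits P.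
Proof.
move=> PP; exists (\rank P), (col_base P), (row_base P); split.
  exact: mulmx_base.
apply: (row_full_inj (col_base_full P)).
apply: (row_free_inj (row_base_free P)).
have PE := mulmx_base P.
rewrite /= -/(row_base P) mulmx1 (mulmxA (col_base P)) -mulmxA.
by rewrite !PE PP.
Qed.

Lemma splits_map (A B : comPzRingType) (phi : {rmorphism A -> B}) m
  (P : 'M[A]_m) : splits P -> splits (map_mx phi P).
Proof.
move=> [r [X [Y [XY YX]]]]; exists r, (map_mx phi X), (map_mx phi Y).
by rewrite -!map_mxM XY YX map_scalar_mx rmorph1.
Qed.

Lemma map_bridge (A B : comPzRingType) (phi : {rmorphism A -> B}) m
  (P Q : 'M[A]_m) :
  map_mx phi (bridge P Q) = bridge (map_mx phi P) (map_mx phi Q).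
Proof.
by rewrite /bridge map_mxD !map_mxM !map_mxB map_scalar_mx rmorph1.
Qed.

(** * Continuity of matrix operations *)

Section MatrixContinuity.
Variables (K : numFieldType) (T : topologicalType).

Lemma continuous_det m (M : T -> 'M[K]_m) (t : T) :
  (forall i j, {for t, continuous (fun s => M s i j)}) ->
  {for t, continuous (fun s => \det (M s))}.
Proof.
move=> cM; rewrite /determinant.
apply: (@cvg_big _ _ +%R) => [|s _]; first exact: add_continuous.
apply: cvgM; first exact: cvg_cst.
apply: (@cvg_big K _ *%R) => [|i _]; first exact: mul_continuous.
exact: cM.
Qed.

Lemma continuous_mulmx m n p (M : T -> 'M[K]_(m, n)) (N : T -> 'M[K]_(n, p))
  (t : T) i k :
  (forall j, {for t, continuous (fun s => M s i j)}) ->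
  (forall j, {for t, continuous (fun s => N s j k)}) ->
  {for t, continuous (fun s => (M s *m N s) i k)}.
Proof.
move=> cM cN.
have -> : (fun s => (M s *m N s) i k) = fun s => \sum_j M s i j * N s j k.
  by apply/funext => s; rewrite mxE.
apply: (@cvg_big _ _ +%R) => [|j _]; first exact: add_continuous.
by apply: cvgM; [exact: cM|exact: cN].
Qed.

Lemma continuous_bridge m (M N : T -> 'M[K]_m) (t : T) :
  (forall i j, {for t, continuous (fun s => M s i j)}) ->
  (forall i j, {for t, continuous (fun s => N s i j)}) ->
  forall i j, {for t, continuous (fun s => bridge (M s) (N s) i j)}.
Proof.
move=> cM cN i j.
have cB (L : T -> 'M[K]_m) :
    (forall i j, {for t, continuous (fun s => L s i j)}) ->
    forall i j, {for t, continuous (fun s => (1%:M - L s) i j)}.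
  move=> cL a b.
  have -> : (fun s => (1%:M - L s) a b) =
      fun s => (1%:M : 'M[K]_m) a b - L s a b.
    by apply/funext => q; rewrite !mxE.
  by apply: cvgB; [exact: cvg_cst|exact: cL].
have -> : (fun s => bridge (M s) (N s) i j) =
    fun s => (M s *m N s) i j + ((1%:M - M s) *m (1%:M - N s)) i j.
  by apply/funext => s; rewrite /bridge mxE.
apply: cvgD; first exact: (continuous_mulmx (cM i) (cN^~ j)).
exact: (continuous_mulmx (cB _ cM i) ((cB _ cN)^~ j)).
Qed.

End MatrixContinuity.

(** * Compactness of the closed polydisc *)

Section ComplexTopology.
Variable R : realType.

Lemma real_complex_continuous : continuous (real_complex R : R -> R[i]).
Proof.
move=> x; apply/cvgrPdist_lt => e e0.
(* the radius of a ball of R[i] is a positive complex number, hence real *)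
have eE : e = (complex.Re e)%:C.
  by apply/esym/RRe_real; rewrite gtr0_real.
move: e0; rewrite eE ltcR => e0.
near=> y; rewrite -rmorphB normc_def /= expr0n /= addr0 sqrtr_sqr ltcR.
by near: y; apply: cvgr_dist_lt.
Unshelve. all: by end_near. Qed.

Lemma closed_unit_disc : closed [set z : R[i] | `|z| <= 1].
Proof.
move=> z clz /=; apply: contrapT => /negP.
rewrite real_leNgt ?normr_real ?real1 // negbK -subr_gt0 => z1.
have [w [/= w1 zw]] := clz _ (nbhsx_ballx z _ z1).
have := zw; rewrite -ball_normE /= => /ltr_leD /(_ w1); rewrite subrK.
by move=> /(le_lt_trans (ler_normD _ _)); rewrite subrK ltxx.
Qed.

(** The disc is a closed part of the continuous image of a real square. *)
Lemma compact_unit_disc : compact [set z : R[i] | `|z| <= 1].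
Proof.
pose toC (p : R * R) : R[i] := p.1%:C + 'i * p.2%:C.
apply: (subclosed_compact closed_unit_disc
  (B := toC @` (`[-1, 1] `*` `[-1, 1]))).
  apply: continuous_compact; last first.
    by apply: compact_setX; exact: segment_compact.
  apply: continuous_subspaceT => p; apply: cvgD.
    by apply: continuous_comp; [exact: cvg_fst|exact: real_complex_continuous].
  apply: cvgM; first exact: cvg_cst.
  by apply: continuous_comp; [exact: cvg_snd|exact: real_complex_continuous].
move=> z /= z1; exists (complex.Re z, complex.Im z) => /=; last first.
  by rewrite /toC /=; case: z {z1} => a b; simpc.
split => /=; rewrite in_itv /= -ler_norml -lecR.
  exact: le_trans (normc_ge_Re z) z1.
apply: le_trans z1; case: z => a b; simpc.
by rewrite -sqrtr_sqr ler_wsqrtr // lerDr sqr_ge0.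
Qed.

End ComplexTopology.

Section Polydisc.
Variables (R : realType) (d : nat).
Notation K := (closed_polydisc R d).

(** Tychonoff's theorem gives compactness as a subset of the space of row
vectors; near coverings carry it over to the subtype. *)
Lemma compact_closed_polydisc : compact [set: K].
Proof.
have cK : compact (closed_polydisc R d).
  exact: (@rV_compact R[i] d (fun=> [set z | `|z| <= 1])
    (fun=> @compact_unit_disc R)).
apply/compact_near_coveringP => J F P FF nearP.
have covK := (compact_near_coveringP _).1 cK J F
  (fun i w => forall z : K, set_val z = w -> P i z) FF.
apply: filterS (covK _) => [i KP z _|w Kw].
  by apply: KP (set_valP z) _ erefl.
have [[U V] [/= Uz FV] UV] := nearP (SigSub (mem_set Kw)) I.
move: Uz; rewrite nbhsE => -[B [[W oW WB] Bz] BU].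
exists (W, V); first split => //=.
  by apply: open_nbhs_nbhs; split => //; move: Bz; rewrite -WB.
move=> [w' i] [/= Ww' Vi] z zw'; apply: (UV (z, i)); split => //=.
by apply: BU; rewrite -WB /= zw'.
Qed.

(** * The contraction of the polydisc to its centre *)

(** Truncating the ratio to [0, 1] lets the parameter of the deformation range
over the whole real line. *)
Definition clip (t : R) : R := Order.min 1 `|t|.

Lemma clip_ge0 t : 0 <= clip t.
Proof. by rewrite le_min ler01 normr_ge0. Qed.

Lemma clip_le1 t : clip t <= 1.
Proof. by rewrite ge_min lexx. Qed.

Lemma clip0 : clip 0 = 0.
Proof. by rewrite /clip normr0 min_r. Qed.

Lemma clip1 : clip 1 = 1.
Proof. by rewrite /clip normr1 minxx. Qed.

Lemma clip_continuous : continuous clip.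
Proof.
apply: (@min_fun_continuous _ R R (fun=> 1) Num.norm).
  by move=> ?; exact: cvg_cst.
exact: norm_continuous.
Qed.

Lemma norm_clip t (z : R[i]) : `|(clip t)%:C * z| <= `|z|.
Proof.
rewrite normrM ger0_norm ?lecR ?clip_ge0 // ler_piMl //.
by rewrite (lecR _ 1) clip_le1.
Qed.

Lemma clip_closed_polydisc t w : K w -> K ((clip t)%:C *: w).
Proof. by move=> Kw j; rewrite mxE; apply: le_trans (norm_clip _ _) (Kw j). Qed.

Lemma clip_polydisc t w :
  polydisc R d w -> polydisc R d ((clip t)%:C *: w).
Proof.
by move=> Dw j; rewrite mxE; apply: le_lt_trans (norm_clip _ _) (Dw j).
Qed.

Definition shrink t (z : K) : K :=
  SigSub (mem_set (clip_closed_polydisc t (set_valP z))).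

Lemma shrink_continuous : continuous (fun p : R * K => shrink p.1 p.2).
Proof.
apply: continuous_comp_initial => p.
apply: cvgZ.
  apply: (@continuous_comp _ _ _ (fun p : R * K => clip p.1) (real_complex R)).
    by apply: continuous_comp; [exact: cvg_fst|exact: clip_continuous].
  exact: real_complex_continuous.
apply: (@continuous_comp _ _ _ snd (set_val : K -> _)); first exact: cvg_snd.
exact: initial_continuous.
Qed.

Lemma origin_in_polydisc : K (0 : 'rV[R[i]]_d).
Proof. by move=> j; rewrite mxE normr0. Qed.

Definition origin : K := SigSub (mem_set origin_in_polydisc).

(** * Evaluations, dilations, constants and units of the algebra *)

Lemma valL_val (f : K -> R[i]) (z : K) : 'valL_0 f (set_val z) = f z.
Proof. exact: (congr1 (@^~ z) (valLK 0 f)). Qed.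

Definition value_at (z : K) (f : Asym R d) : R[i] := val f z.

Lemma value_at_is_zmod_morphism z : zmod_morphism (value_at z).
Proof. by []. Qed.
Lemma value_at_is_monoid_morphism z : monoid_morphism (value_at z).
Proof. by []. Qed.
HB.instance Definition _ z :=
  GRing.isZmodMorphism.Build _ _ (value_at z) (value_at_is_zmod_morphism z).
HB.instance Definition _ z :=
  GRing.isMonoidMorphism.Build _ _ (value_at z) (value_at_is_monoid_morphism z).

Lemma Asym_ext (f g : Asym R d) :
  (forall z, value_at z f = value_at z g) -> f = g.
Proof. by move=> fg; apply/val_inj/funext. Qed.

Lemma Asym_continuous (f : Asym R d) : continuous (fun z : K => value_at z f).
Proof. by have := valP f; rewrite inE => -[[]]. Qed.

Lemma near_eq_differentiable (f g : 'rV[R[i]]_d -> R[i]) z :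
  (\forall w \near z, f w = g w) -> differentiable g z -> differentiable f z.
Proof.
move=> fg dg.
have dfg : differentiable (f - g) z.
  apply: (@differentiable_near_cst _ _ _ 0).
  by apply: filterS fg => w fgw; rewrite !fctE fgw subrr.
by have := differentiableD dfg dg; rewrite subrK.
Qed.

Lemma dilation_subproof t (f : Asym R d) :
  (fun z : K => value_at (shrink t z) f) \in @sym_polydisc_algebra R d.
Proof.
have := valP f; rewrite !inE => -[[hf cf] sf].
have valLE w : polydisc R d w ->
    'valL_0 (fun z : K => value_at (shrink t z) f) w =
    'valL_0 (val f) ((clip t)%:C *: w).
  move=> Dw; pose z : K := SigSub (mem_set (polydiscW Dw)).
  rewrite -[w]/(set_val z) valL_val.
  by rewrite -[_ *: _]/(set_val (shrink t z)) valL_val.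
split; [split|].
- move=> z Dz.
  apply: (@near_eq_differentiable _ ('valL_0 (val f) \o ((clip t)%:C *: id))).
    by apply: filterS (polydisc_nbhs Dz) => w; exact: valLE.
  apply: differentiable_comp; first exact: differentiableZ.
  by apply: hf; exact: clip_polydisc.
- move=> z; apply: (@continuous_comp _ _ _ (shrink t) (val f)).
    apply: (@continuous_comp _ _ _ (pair t) (fun p => shrink p.1 p.2)).
      apply: (@cvg_pair _ _ _ (nbhs z) (nbhs t) (nbhs z)).
        exact: cvg_cst.
      exact: cvg_id.
    exact: shrink_continuous.
  exact: cf.
- move=> s z Dz; rewrite !valLE //; last exact: polydisc_perm.
  have -> : (clip t)%:C *: col_perm s z = col_perm s ((clip t)%:C *: z).
    by apply/matrixP => i j; rewrite !mxE.
  by apply: sf; exact: clip_polydisc.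
Qed.

Definition dilation t (f : Asym R d) : Asym R d :=
  exist (fun g => g \in @sym_polydisc_algebra R d) _ (dilation_subproof t f).

Lemma value_at_dilation t f z :
  value_at z (dilation t f) = value_at (shrink t z) f.
Proof. by []. Qed.

Lemma dilation_is_zmod_morphism t : zmod_morphism (dilation t).
Proof. by move=> f g; exact: Asym_ext. Qed.
Lemma dilation_is_monoid_morphism t : monoid_morphism (dilation t).
Proof. by split=> [|f g]; exact: Asym_ext. Qed.
HB.instance Definition _ t :=
  GRing.isZmodMorphism.Build _ _ (dilation t) (dilation_is_zmod_morphism t).
HB.instance Definition _ t :=
  GRing.isMonoidMorphism.Build _ _ (dilation t) (dilation_is_monoid_morphism t).

Lemma valL_cst (c : R[i]) w : polydisc R d w -> 'valL_0 (fun _ : K => c) w = c.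
Proof.
move=> Dw; pose z : K := SigSub (mem_set (polydiscW Dw)).
by rewrite -[w]/(set_val z) valL_val.
Qed.

Lemma Asym_cst_subproof (c : R[i]) :
  (fun _ : K => c) \in @sym_polydisc_algebra R d.
Proof.
rewrite inE; split; [split|].
- move=> z Dz; apply: (@differentiable_near_cst _ _ _ c).
  by apply: filterS (polydisc_nbhs Dz) => w; exact: valL_cst.
- exact: cst_continuous.
- by move=> s z Dz; rewrite !valL_cst //; exact: polydisc_perm.
Qed.

Definition Asym_cst (c : R[i]) : Asym R d :=
  exist (fun g => g \in @sym_polydisc_algebra R d) _ (Asym_cst_subproof c).

Lemma Asym_cst_is_zmod_morphism : zmod_morphism Asym_cst.
Proof. by move=> a b; exact: Asym_ext. Qed.
Lemma Asym_cst_is_monoid_morphism : monoid_morphism Asym_cst.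
Proof. by split=> [|a b]; exact: Asym_ext. Qed.
HB.instance Definition _ :=
  GRing.isZmodMorphism.Build _ _ Asym_cst Asym_cst_is_zmod_morphism.
HB.instance Definition _ :=
  GRing.isMonoidMorphism.Build _ _ Asym_cst Asym_cst_is_monoid_morphism.

Lemma dilation1 f : dilation 1 f = f.
Proof.
apply: Asym_ext => z; rewrite value_at_dilation; congr (value_at _ f).
by apply: val_inj => /=; rewrite clip1 scale1r.
Qed.

Lemma dilation0 f : dilation 0 f = Asym_cst (value_at origin f).
Proof.
apply: Asym_ext => z; rewrite value_at_dilation -[RHS]/(value_at origin f).
by congr (value_at _ f); apply: val_inj => /=; rewrite clip0 scale0r.
Qed.

Lemma valLV (f : K -> R[i]) :
  'valL_0 (fun z => (f z)^-1) = fun w => ('valL_0 f w)^-1.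
Proof.
apply/funext => z; rewrite /valL_ /= oinv_set_val.
by case: insub => [x|] /=; rewrite ?invr0.
Qed.

(** The pointwise inverse inherits holomorphy, continuity and symmetry. *)
Lemma Asym_invertible (f : Asym R d) :
  (forall z, value_at z f != 0) -> exists g, f * g = 1.
Proof.
move=> f0; have := valP f; rewrite !inE => -[[hf cf] sf].
have Vf : (fun z => (val f z)^-1) \in @sym_polydisc_algebra R d.
  rewrite inE; split; [split|].
  - move=> z Dz; rewrite valLV; apply: differentiableV; first exact: hf.
    pose z' : K := SigSub (mem_set (polydiscW Dz)).
    by rewrite -[z]/(set_val z') valL_val; exact: f0.
  - by move=> z; apply: continuousV; [exact: (f0 z)|exact: cf].
  - by move=> s z Dz; rewrite valLV sf.
exists (exist (fun g => g \in @sym_polydisc_algebra R d) _ Vf).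
by apply: Asym_ext => z; rewrite rmorphM rmorph1; exact: divff (f0 z).
Qed.

(** * The deformation of an idempotent to a constant one *)

Section Deformation.
Variables (m : nat) (P : 'M[Asym R d]_m).
Hypothesis PP : P *m P = P.

Let Pt t := map_mx (dilation t) P.

Let PtP t : Pt t *m Pt t = Pt t.
Proof. by rewrite -map_mxM PP. Qed.

Lemma bridge_continuous s : continuous (fun p : K * R =>
  value_at p.1 (\det (bridge (Pt s) (Pt p.2)))).
Proof.
move=> p.
have cPt (c : K * R -> R) i j : continuous c ->
    {for p, continuous (fun p => map_mx (value_at p.1) (Pt (c p)) i j)}.
  move=> cc.
  have -> : (fun p => map_mx (value_at p.1) (Pt (c p)) i j) =
      fun p => value_at (shrink (c p) p.1) (P i j).
    by apply/funext => q; rewrite !mxE.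
  apply: (@continuous_comp _ _ _ (fun p => shrink (c p) p.1)
    (fun z : K => value_at z (P i j))); last exact: Asym_continuous.
  apply: (@continuous_comp _ _ _ (fun p => (c p, p.1))
    (fun p => shrink p.1 p.2)); last exact: shrink_continuous.
  apply: (@cvg_pair _ _ _ (nbhs p) (nbhs (c p)) (nbhs p.1)).
    exact: cc.
  exact: cvg_fst.
have -> : (fun p : K * R => value_at p.1 (\det (bridge (Pt s) (Pt p.2)))) =
    fun p => \det (bridge (map_mx (value_at p.1) (Pt s))
                          (map_mx (value_at p.1) (Pt p.2))).
  by apply/funext => q; rewrite -map_bridge det_map_mx.
apply: (@continuous_det R[i] _ m (fun p : K * R =>
  bridge (map_mx (value_at p.1) (Pt s)) (map_mx (value_at p.1) (Pt p.2))) p).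
apply: continuous_bridge => i j.
  by apply: (cPt (fun=> s)) => q; exact: cvg_cst.
by apply: (cPt snd) => q; exact: cvg_snd.
Qed.

(** The determinant of the bridge from P_s to P_t is 1 at t = s; compactness
makes the neighbourhood of s where it is nonzero uniform in z. *)
Lemma near_splits s : \forall t \near s, splits (Pt t) <-> splits (Pt s).
Proof.
have detN0 : \forall t \near s,
    [set: K] `<=` [set z | value_at z (\det (bridge (Pt s) (Pt t))) != 0].
  apply: ((compact_near_coveringP _).1 compact_closed_polydisc _ (nbhs s)
    (fun t z => value_at z (\det (bridge (Pt s) (Pt t))) != 0)).
  move=> z _.
  have zs1 : value_at z (\det (bridge (Pt s) (Pt s))) != 0.
    by rewrite bridgexx ?PtP // det1 rmorph1 oner_neq0.
  apply: (cvgr_neq0 (value_at z (\det (bridge (Pt s) (Pt s))))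
    (@bridge_continuous s (z, s)) zs1).
apply: filterS detN0 => t Bt.
have [c detc] := Asym_invertible (fun z => Bt z I).
by have := splits_bridge (PtP s) (PtP t) detc; tauto.
Qed.

Lemma splits_idempotent : splits P.
Proof.
pose S := [set t | splits (Pt t)].
have S0 : S 0.
  have -> : S 0 = splits (map_mx Asym_cst (map_mx (value_at origin) P)).
    by congr splits; apply/matrixP => i j; rewrite !mxE dilation0.
  by apply/splits_map/splits_field; rewrite -map_mxM PP.
have Sop : open S.
  by rewrite openE => t St; apply: filterS (near_splits t) => u [_]; exact.
have Scl : closed S.
  rewrite -openC openE => t nSt; apply: filterS (near_splits t) => u [Sut _].
  by move=> /Sut.
have ST : S = setT.
  have /connected_intervalP cT : is_interval [set: R] by [].
  by apply: cT; [exists 0|exists S; rewrite ?setTI|exists S; rewrite ?setTI].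
have P1 : Pt 1 = P by apply/matrixP => i j; rewrite !mxE dilation1.
have : S 1 by rewrite ST.
by rewrite /S /= P1.
Qed.

End Deformation.

End Polydisc.

Theorem corollary4p2 (R : realType) (d : nat) (hd : (0 < d)%N) :
  projective_free (Asym R d).
Proof.
by apply: projective_free_splits => m P; exact: splits_idempotent.
Qed.
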